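(* Let $(D,X)$ be a Dyer system. Let $g\in D$ and $Y,Z\subseteq X$ be such that $gD_Yg^{-1}\subseteq D_Z$. Then there exist $h\in D_Z$ and $Y'\subseteq Z$ such that $gD_Yg^{-1}=hD_{Y'}h^{-1}$.
   Context: A Dyer graph is a finite simplicial graph $\Gamma$ with vertex set $V(\Gamma)$ and edge set $E(\Gamma)$, together with a vertex labelling $f\colon V(\Gamma)\to\mathbb{N}_{\geq 2}\cup\{\infty\}$ and an edge labelling $m\colon E(\Gamma)\to\mathbb{N}_{>2}\cup\{\infty\}$ such that for every edge $\{u,v\}\in E(\Gamma)$, if $f(v)\geq 3$ (including $f(v)=\infty$), then $m(u,v)=\infty$. The labelling $m$ is extended to all pairs of distinct vertices by $m(u,v)=2$ if $\{u,v\}\notin E(\Gamma)$. The associated Dyer group is $$D(\Gamma)=\langle V(\Gamma)\mid v^{f(v)}=1 \text{ for all } v \text{ with } f(v)<\infty,\ \underbrace{uvu\cdots}_{m(u,v)\text{ terms}}=\underbrace{vuv\cdots}_{m(u,v)\text{ terms}}\text{ for all } \{u,v\}\text{ with } m(u,v)\neq\infty\rangle.$$ A Dyer system is a pair $(D,X)$ where $D$ is a group and $X\subseteq D$ is a generating set such that there exist a Dyer graph $\Gamma$ and a group isomorphism $D(\Gamma)\to D$ mapping $V(\Gamma)$ bijectively onto $X$. For $Y\subseteq X$, $D_Y$ denotes the subgroup of $D$ generated by $Y$ (the standard parabolic subgroup associated with $Y$). *)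

(* Defs.v *)
From HB Require Import structures.
From mathcomp Require Import all_boot.
From mathcomp Require Import boolp classical_sets functions.

Set Implicit Arguments.
Unset Strict Implicit.
Unset Printing Implicit Defensive.

Local Open Scope quotient_scope.
Local Open Scope group_scope.
Local Open Scope classical_set_scope.

(* The group < V | w1 = w2 for all R w1 w2 >, as the quotient of the free monoid
   on V + V^-1 by the congruence generated by R and by v v^-1 = v^-1 v = 1. The
   letter (v, true) stands for v and (v, false) for v^-1. *)
Section Presentation.
Variables (V : choiceType) (R : seq (V * bool) -> seq (V * bool) -> Prop).
Implicit Types (a b w : seq (V * bool)).

Inductive pres_cong : seq (V * bool) -> seq (V * bool) -> Prop :=
| pres_rel w1 w2 of R w1 w2 : pres_cong w1 w2
| pres_cancel v e : pres_cong [:: (v, e); (v, ~~ e)] [::]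
| pres_refl w : pres_cong w w
| pres_sym w1 w2 of pres_cong w1 w2 : pres_cong w2 w1
| pres_trans w1 w2 w3 of pres_cong w1 w2 & pres_cong w2 w3 : pres_cong w1 w3
| pres_cat w1 w2 w1' w2' of pres_cong w1 w1' & pres_cong w2 w2' :
    pres_cong (w1 ++ w2) (w1' ++ w2').

Definition pres_eq w1 w2 : bool := `[< pres_cong w1 w2 >].

Fact pres_eq_refl : reflexive pres_eq.
Proof. by move=> w; apply/asboolP; exact: pres_refl. Qed.

Fact pres_eq_sym : symmetric pres_eq.
Proof. by move=> w1 w2; apply/asboolP/asboolP; exact: pres_sym. Qed.

Fact pres_eq_trans : transitive pres_eq.
Proof.
move=> w2 w1 w3 /asboolP w12 /asboolP w23.
by apply/asboolP; exact: pres_trans w12 w23.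
Qed.

Canonical pres_equiv := EquivRel pres_eq pres_eq_refl pres_eq_sym pres_eq_trans.

Definition presented := {eq_quot pres_equiv}.
HB.instance Definition _ := Choice.on presented.
HB.instance Definition _ := EqQuotient.on presented.

Definition pres_word w : presented := \pi w.

Lemma pres_wordP w1 w2 : pres_word w1 = pres_word w2 <-> pres_cong w1 w2.
Proof. by split=> [/eqmodP/asboolP//|w12]; apply/eqmodP/asboolP. Qed.

Definition winv w : seq (V * bool) := rev [seq (x.1, ~~ x.2) | x <- w].

Lemma winvK : involutive winv.
Proof.
move=> w; rewrite /winv map_rev revK -map_comp -[RHS]map_id.
by apply: eq_map => -[v e] /=; rewrite negbK.
Qed.

Lemma winv_cat w1 w2 : winv (w1 ++ w2) = winv w2 ++ winv w1.
Proof. by rewrite /winv map_cat rev_cat. Qed.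

Lemma pres_winvr w : pres_cong (w ++ winv w) [::].
Proof.
elim: w => [|[v e] w IHw]; first exact: pres_refl.
rewrite -cat1s winv_cat -catA [w ++ _]catA.
apply: pres_trans (pres_cancel v e); apply: pres_cat (pres_refl _) _.
exact: (pres_cat IHw (pres_refl _)).
Qed.

Lemma pres_winvl w : pres_cong (winv w ++ w) [::].
Proof. by have := pres_winvr (winv w); rewrite winvK. Qed.

Lemma pres_winv w1 w2 : pres_cong w1 w2 -> pres_cong (winv w1) (winv w2).
Proof.
move=> w12; apply: (@pres_trans _ (winv w1 ++ (w2 ++ winv w2))).
  rewrite -{1}[winv w1]cats0; apply: pres_cat (pres_refl _) _.
  exact/pres_sym/pres_winvr.
rewrite catA -{2}[winv w2]cat0s; apply: pres_cat (pres_refl _).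
apply: pres_trans (pres_winvl w1).
exact: pres_cat (pres_refl _) (pres_sym w12).
Qed.

Definition pres_one : presented := pres_word [::].
Definition pres_mul (x y : presented) : presented :=
  pres_word (repr x ++ repr y).
Definition pres_inv (x : presented) : presented := pres_word (winv (repr x)).

Lemma pres_repr w : pres_cong (repr (pres_word w)) w.
Proof. by apply/pres_wordP; rewrite /pres_word reprK. Qed.

Lemma pres_mulE w1 w2 :
  pres_mul (pres_word w1) (pres_word w2) = pres_word (w1 ++ w2).
Proof. by apply/pres_wordP; apply: pres_cat; exact: pres_repr. Qed.

Lemma pres_invE w : pres_inv (pres_word w) = pres_word (winv w).
Proof. by apply/pres_wordP; apply: pres_winv; exact: pres_repr. Qed.

Lemma pres_ind (P : presented -> Prop) :
  (forall w, P (pres_word w)) -> forall x, P x.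
Proof. by move=> Pw x; rewrite -[x]reprK; exact: Pw. Qed.

Fact pres_mulA : associative pres_mul.
Proof.
elim/pres_ind=> a; elim/pres_ind=> b; elim/pres_ind=> c.
by rewrite !pres_mulE catA.
Qed.

Fact pres_mul1g : left_id pres_one pres_mul.
Proof. by elim/pres_ind=> a; rewrite pres_mulE. Qed.

Fact pres_mulg1 : right_id pres_one pres_mul.
Proof. by elim/pres_ind=> a; rewrite pres_mulE cats0. Qed.

Fact pres_mulVg : left_inverse pres_one pres_inv pres_mul.
Proof.
elim/pres_ind=> a; rewrite pres_invE pres_mulE.
by apply/pres_wordP; exact: pres_winvl.
Qed.

Fact pres_mulgV : right_inverse pres_one pres_inv pres_mul.
Proof.
elim/pres_ind=> a; rewrite pres_invE pres_mulE.
by apply/pres_wordP; exact: pres_winvr.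
Qed.

HB.instance Definition _ := isGroup.Build presented
  pres_mulA pres_mul1g pres_mulg1 pres_mulVg pres_mulgV.

Definition pres_gen (v : V) : presented := pres_word [:: (v, true)].

End Presentation.

(* Labels in N u {oo} are of type [option nat], with None for oo. *)
Definition label_ge (n : nat) (l : option nat) : bool :=
  if l is Some k then n <= k else true.

(* The values of [edge_label] on non-edges are irrelevant. *)
Record dyerGraph := DyerGraph {
  vertex :> finType;
  edge : rel vertex;
  edge_sym : symmetric edge;
  edge_irr : irreflexive edge;
  vertex_label : vertex -> option nat;
  vertex_label_ge2 : forall v, label_ge 2 (vertex_label v);
  edge_label : vertex -> vertex -> option nat;
  edge_label_sym : forall u v, edge u v -> edge_label u v = edge_label v u;
  edge_label_gt2 : forall u v, edge u v -> label_ge 3 (edge_label u v);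
  edge_label_oo : forall u v,
    edge u v -> label_ge 3 (vertex_label v) -> edge_label u v = None
}.

Section DyerGroup.
Variable G : dyerGraph.

Definition dyer_label (u v : G) : option nat :=
  if edge u v then edge_label u v else Some 2.

(* u v u ... with n letters *)
Fixpoint alt_word (n : nat) (u v : G) : seq (G * bool) :=
  if n is n'.+1 then (u, true) :: alt_word n' v u else [::].

Inductive dyer_rel : seq (G * bool) -> seq (G * bool) -> Prop :=
| dyer_torsion v n of vertex_label v = Some n :
    dyer_rel (nseq n (v, true)) [::]
| dyer_braid u v n of u != v & dyer_label u v = Some n :
    dyer_rel (alt_word n u v) (alt_word n v u).

Definition dyer_group := presented dyer_rel.
HB.instance Definition _ := Group.on dyer_group.

Definition dyer_gen (v : G) : dyer_group := pres_gen dyer_rel v.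

End DyerGroup.

Section Subgroups.
Variable D : groupType.

Definition generated (A : set D) : set D :=
  smallest (fun H : set D => group_closed (mem H)) A.

(* g A g^-1; the library's x ^ g is g^-1 x g. *)
Definition conj_set (g : D) (A : set D) : set D := [set g * x / g | x in A].

Definition dyer_system (X : set D) : Prop :=
  generated X = setT /\
  exists (G : dyerGraph) (phi : {multiplicative dyer_group G -> D}),
    bijective phi /\ set_bij setT X (fun v : G => phi (dyer_gen v)).

End Subgroups.

(* Main.v *)
(* Deleting from a word all letters with reflection t multiplies its value on
   the left by a power of t, and the new value depends only on the old one
   (deletion commutes with the defining relations; in a braid relation of length
   at least 3 the generators are involutions, so both sides carry the same
   reflections in opposite orders). Write g = z d with z in D_Z and d of minimal
   word length in D_Z g: for t in D_Z, deleting t from a shortest word for d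
   changes nothing, as it would yield a shorter element of D_Z d. For y in Y
   put c = d y d^-1, which lies in D_Z. Since d y = c d, deleting a reflection
   t <> c of D_Z from a word for c preserves the value c. The first letter of a
   word has its own vertex as reflection, so a shortest word for c in letters of
   Z^(+-1) is empty or starts with a letter of vertex c. Hence d Y d^-1 is
   contained in Z u {1}. *)

Require Import Defs.
From HB Require Import structures.
From mathcomp Require Import all_boot.
From mathcomp Require Import boolp classical_sets functions.

Set Implicit Arguments.
Unset Strict Implicit.
Unset Printing Implicit Defensive.

Local Open Scope group_scope.
Local Open Scope classical_set_scope.

(** * Generated subgroups and conjugation *)

Section GeneratedSubgroup.
Variable D : groupType.
Implicit Types (A H : set D) (g : D).

Lemma group_closed_setP H :
  group_closed (mem H) <-> H 1 /\ forall a b, H a -> H b -> H (a / b).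
Proof.
have memH a : (a \in [eta mem H]) <-> H a by rewrite -[H a]in_setE.
rewrite /group_closed memH; split=> -[H1 HF]; split=> // a b.
  by rewrite -!memH; exact: HF.
by move=> /memH Ha /memH Hb; apply/memH; exact: HF.
Qed.

Lemma generated_closed A : group_closed (mem (generated A)).
Proof.
apply/group_closed_setP; split=> [H [/group_closed_setP[]] //|a b Aa Ab H HA].
have [/group_closed_setP[_ HF] _] := HA; apply: HF; [exact: Aa | exact: Ab].
Qed.

Lemma generated1 A : generated A 1.
Proof. by have /group_closed_setP[] := generated_closed A. Qed.

Lemma generated_div A a b :
  generated A a -> generated A b -> generated A (a / b).
Proof. by have /group_closed_setP[_] := generated_closed A; apply. Qed.

Lemma generated_conj A a b :
  generated A a -> generated A b -> generated A (a ^ b).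
Proof.
move=> Aa Ab; have AV c : generated A c -> generated A c^-1.
  by rewrite -div1g; apply: generated_div; exact: generated1.
rewrite conjgE -[a * b]invgK invgM.
exact: generated_div (AV _ Ab) (generated_div (AV _ Ab) Aa).
Qed.

Lemma sub_generated A : A `<=` generated A.
Proof. by move=> a Aa H [_]; apply. Qed.

Lemma generated_sub A H : group_closed (mem H) -> A `<=` H -> generated A `<=` H.
Proof. by move=> Hgc AH a; apply. Qed.

Lemma group_closed_conj g H : group_closed (mem H) ->
  group_closed (mem [set a | H (a ^ g)]).
Proof.
move=> /group_closed_setP[H1 HF]; apply/group_closed_setP; rewrite /= conj1g.
by split=> // a b Ha Hb; rewrite conjMg conjVg; exact: HF.
Qed.

Lemma conj_setE g A a : conj_set g A a <-> A (a ^ g).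
Proof.
split=> [[b Ab <-]|Aag]; last by exists (a ^ g); rewrite // conjgE mulVKg mulgK.
by rewrite conjgE mulgVK mulKg.
Qed.

End GeneratedSubgroup.

Lemma mulg_expg_swap (D : groupType) (a b : D) n :
  a * (b * a) ^+ n = (a * b) ^+ n * a.
Proof.
have ->: b * a = (a * b) ^ a by rewrite conjgE -mulgA mulKg.
by rewrite -conjXg -conjgC.
Qed.

(** * Words, their values, and deletion of a reflection *)

Section Deletion.
Variables (G : dyerGraph) (D : groupType) (x : G -> D).
Implicit Types (l : G * bool) (w : seq (G * bool)) (t : D) (u v : G).

Definition letter l : D := if l.2 then x l.1 else (x l.1)^-1.

Definition eval w : D := \prod_(l <- w) letter l.

(* Attach to the i-th letter of l_1 ... l_n, of vertex v, the reflection
   (l_1 ... l_(i-1)) x_v (l_1 ... l_(i-1))^-1; [del t] removes every letter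
   whose reflection is [t]. *)
Fixpoint del t w : seq (G * bool) :=
  if w is l :: w' then
    let w1 := del (t ^ letter l) w' in if x l.1 == t then w1 else l :: w1
  else [::].

Lemma eval_cons l w : eval (l :: w) = letter l * eval w.
Proof. exact: big_cons. Qed.

Lemma eval_nil : eval [::] = 1.
Proof. exact: big_nil. Qed.

Lemma eval_cat w1 w2 : eval (w1 ++ w2) = eval w1 * eval w2.
Proof. exact: big_cat. Qed.

Lemma letter_fix v e : x v ^ letter (v, e) = x v.
Proof. by case: e; rewrite /letter /= conjgE ?mulKg // mulgV mulg1 invgK. Qed.

Lemma del_cat t w1 w2 : del t (w1 ++ w2) = del t w1 ++ del (t ^ eval w1) w2.
Proof.
elim: w1 t => [|l w1 IHw] t; first by rewrite eval_nil conjg1.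
by rewrite eval_cons conjgM /= IHw; case: ifP.
Qed.

Lemma size_del t w : size (del t w) <= size w.
Proof.
elim: w t => //= l w IHw t; case: ifP => _ /=; last exact: IHw.
exact: leq_trans (IHw _) (leqnSn _).
Qed.

Lemma del_id t w : size w <= size (del t w) -> del t w = w.
Proof.
elim: w t => //= l w IHw t; case: ifP => _ /= sz.
  by move: (leq_trans sz (size_del _ _)); rewrite ltnn.
by rewrite IHw.
Qed.

Lemma all_del (p : pred (G * bool)) t w : all p w -> all p (del t w).
Proof.
elim: w t => //= l w IHw t /andP[pl pw].
by case: ifP => _ /=; rewrite ?pl IHw.
Qed.

(** A deleted letter equals [t] or its inverse; a kept one conjugates [t], so the induction must
    also let [H] vary among its conjugates. *)
Lemma eval_del_coset (H : set D) t w :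
  group_closed (mem H) -> H t -> H (eval (del t w) / eval w).
Proof.
elim: w t H => [|[v e] w IHw] t H Hgc Ht /=.
  by rewrite mulgV; have /group_closed_setP[] := Hgc.
case: eqP => [xvt|_]; rewrite eval_cons.
  have /group_closed_setP[H1 HF] := Hgc.
  rewrite -xvt letter_fix xvt invgM mulgA; apply: (HF); first exact: IHw.
  by rewrite /letter /= xvt; case: e => //; rewrite -div1g; exact: HF.
rewrite eval_cons; set a := letter _.
have := IHw (t ^ a) _ (group_closed_conj a^-1 Hgc) => /=; rewrite conjgK.
by rewrite conjgE invgK invgM !mulgA; apply.
Qed.

(** * Reflections of positive and alternating words *)

Fixpoint reflections w : seq D :=
  if w is l :: w' then x l.1 :: [seq r ^ (letter l)^-1 | r <- reflections w']
  else [::].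

(** Without inverse letters every deletion costs the same left factor [t^-1], so the order of the
    reflections does not matter. *)
Lemma eval_del_pos t w : all snd w ->
  eval (del t w) = t ^- (count_mem t (reflections w)) * eval w.
Proof.
elim: w t => [|[v e] w IHw] t /=; first by rewrite expg0 invg1 mul1g.
case/andP=> /= -> w_pos; have lE : letter (v, true) = x v by [].
rewrite eval_cons count_map (@eq_count _ _ (pred1 (t ^ x v))) => [|r] /=; last first.
  by rewrite lE -(can2_eq (conjgKV _) (conjgK _)) ?invgK.
rewrite lE; case: eqP => [<-|_] /=.
  by rewrite (letter_fix v true) IHw // expgS invgM mulgA mulgVK.
by rewrite eval_cons IHw // add0n -conjXg -conjVg lE conjgE !mulgA mulgV mul1g.
Qed.

Lemma alt_word_pos n u v : all snd (alt_word n u v).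
Proof. by elim: n u v => //= n IHn u v. Qed.

(** For involutions this turns the braid relation into [(x u * x v) ^+ n = 1]. *)
Lemma eval_alt_word n u v : (x u)^-1 = x u -> (x v)^-1 = x v ->
  eval (alt_word n u v) = (x u * x v) ^+ n * eval (alt_word n v u).
Proof.
move=> u2 v2; elim: n u v u2 v2 => [|n IHn] u v u2 v2; first by rewrite mul1g.
rewrite /= !eval_cons /letter /= (IHn v u) // mulgA mulg_expg_swap expgSr.
by rewrite -!mulgA -{3}v2 mulKg.
Qed.

Lemma reflections_alt_word n u v : (x u)^-1 = x u -> (x v)^-1 = x v ->
  reflections (alt_word n u v)
  = [seq (x u * x v) ^+ i * x u | i <- iota 0 n].
Proof.
move=> u2 v2; elim: n u v u2 v2 => //= n IHn u v u2 v2.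
rewrite expg0 mul1g (IHn v u) // (iotaDl 1 0) -!map_comp; congr (_ :: _).
apply: eq_map => i /=; rewrite /letter /= conjgE invgK u2 !mulgA.
by rewrite mulg_expg_swap expgSr !mulgA.
Qed.

(** With [c = x u * x v], reflection [i] of the swapped word is [c ^- i * x v], which is
    [c ^+ (n - i.+1) * x u] since [c ^+ n = 1]. *)
Lemma reflections_alt_word_rev n u v : (x u)^-1 = x u -> (x v)^-1 = x v ->
  (x u * x v) ^+ n = 1 ->
  reflections (alt_word n v u) = rev (reflections (alt_word n u v)).
Proof.
move=> u2 v2 cn; rewrite !reflections_alt_word //.
apply: (@eq_from_nth _ 1); rewrite ?size_rev ?size_map // size_iota => i ltin.
have lt' : n - i.+1 < n by rewrite ltn_subrL; case: n ltin {cn}.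
rewrite nth_rev ?size_map ?size_iota // !(nth_map 0) ?size_iota // !nth_iota //.
rewrite !add0n expgnFr // cn div1g -expVgn invgM u2 v2 expgSr -!mulgA.
by rewrite -{4}u2 mulgV mulg1.
Qed.

(** * Compatibility of deletion with the defining relations *)

Section WellDefined.
Hypothesis evalP :
  forall w1 w2, eval w1 = eval w2 <-> pres_cong (@dyer_rel G) w1 w2.

Lemma eval_rel w1 w2 : dyer_rel w1 w2 -> eval w1 = eval w2.
Proof. by move=> w12; apply/evalP/pres_rel. Qed.

Lemma eq_conj_letter v e t : (x v == t ^ letter (v, e)) = (x v == t).
Proof. by rewrite -{1}(letter_fix v e) (inj_eq (@conjg_inj _ _)). Qed.

Lemma del_nseq t n v :
  del t (nseq n (v, true)) = if x v == t then [::] else nseq n (v, true).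
Proof.
elim: n t => [|n IHn] t /=; first by rewrite if_same.
by rewrite IHn eq_conj_letter; case: (x v == t).
Qed.

(** A vertex label of at least 3 would make the edge label infinite, so [v] has label 2 and its
    torsion relation applies. *)
Lemma edge_label_involution u v n :
  edge u v -> edge_label u v = Some n -> (x v)^-1 = x v.
Proof.
move=> uv lab; have := vertex_label_ge2 v; have := edge_label_oo uv.
case labv: (vertex_label v) => [[|[|[|k]]]|] //=; rewrite ?lab; try by move/(_ isT).
move=> _ _; have := eval_rel (dyer_torsion labv).
by rewrite /= !eval_cons eval_nil mulg1 => /mulg1_eq.
Qed.

Lemma eval_del_rel t w1 w2 :
  dyer_rel w1 w2 -> eval (del t w1) = eval (del t w2).
Proof.
move=> w12; have := eval_rel w12.
(* In a torsion relation every letter has reflection [x v]: all are deleted or none. *)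
case: w12 => [v n _|u v n _]; first by rewrite del_nseq; case: ifP.
rewrite /dyer_label; case: ifP => [uv lab|_ [<-]].
  have u2 : (x u)^-1 = x u.
    by apply: (@edge_label_involution v u n); rewrite -1?edge_label_sym // edge_sym.
  have v2 := edge_label_involution uv lab.
  move=> E; rewrite !eval_del_pos ?alt_word_pos // E.
  rewrite (@reflections_alt_word_rev n u v) // ?count_rev //.
  by apply: (mulIg (eval (alt_word n v u))); rewrite mul1g -eval_alt_word.
(* Nonadjacent vertices may have any order, but they commute, so the reflection of each letter is
   its own generator. *)
rewrite /= !eval_cons eval_nil !mulg1 /letter /= => uv.
have xvE : x v == t ^ x u = (x v == t).
  by rewrite -{1}(mulKg (x u) (x v)) uv -conjgE (inj_eq (@conjg_inj _ _)).
have xuE : x u == t ^ x v = (x u == t).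
  by rewrite -{1}(mulKg (x v) (x u)) -uv -conjgE (inj_eq (@conjg_inj _ _)).
rewrite xvE xuE; case: ifP => _; case: ifP => _ //.
by rewrite !eval_cons eval_nil !mulg1.
Qed.

(** In a concatenation the second factor sees [t] conjugated by the value of the first, which the
    congruence preserves. *)
Lemma eval_del t w1 w2 : eval w1 = eval w2 -> eval (del t w1) = eval (del t w2).
Proof.
move=> /evalP w12; elim: w12 t => {w1 w2}.
- by move=> w1 w2 w12 t; exact: eval_del_rel.
- move=> v e t /=; rewrite eq_conj_letter; case: (x v == t) => //=.
  exact/evalP/pres_cancel.
- by [].
- by move=> w1 w2 _ IH t.
- by move=> w1 w2 w3 _ IH1 _ IH2 t; rewrite IH1.
- move=> w1 w2 w1' w2' /evalP w12 IH1 _ IH2 t.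
  by rewrite !del_cat !eval_cat IH1 w12 IH2.
Qed.

Hypothesis eval_surj : forall g, exists w, eval w = g.

(** * Shortest words in parabolic subgroups and their cosets *)

Section Parabolic.
Variable Z : set D.
Hypothesis hZ : Z `<=` range x.

Let H := generated Z.

Lemma parabolic_word :
  H `<=` [set eval w | w in [set w | all (fun l => `[< Z (x l.1) >]) w]].
Proof.
apply: generated_sub => [|z Zz /=]; last first.
  have [v _ vz] := hZ Zz; exists [:: (v, true)] => /=.
    by rewrite andbT vz; apply/asboolP.
  by rewrite eval_cons eval_nil mulg1.
apply/group_closed_setP; split=> [|_ _ [a aZ <-] [b bZ <-]].
  by exists [::]; rewrite ?eval_nil.
exists (a ++ winv b).
  rewrite /= all_cat aZ all_rev all_map; apply: sub_all bZ => -[v e] //.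
rewrite eval_cat; congr (_ * _); apply/esym/mulg1_eq.
by rewrite -eval_cat -eval_nil; apply/evalP/pres_winvr.
Qed.

(* The witness is a shortest word whose value lies in the coset [H g]. *)
Lemma reduced_coset_word g :
  exists2 w, H (g / eval w) & forall t, H t -> del t w = w.
Proof.
pose P n := `[< exists2 w, size w = n & H (g / eval w) >].
have exP : exists n, P n.
  have [w wg] := eval_surj g; exists (size w); apply/asboolP.
  by exists w => //; rewrite wg mulgV; exact: generated1.
case: (ex_minnP exP) => n /asboolP[w <- Hw] wmin; exists w => // t Ht.
apply/del_id/wmin/asboolP; exists (del t w) => //.
rewrite -(mulgKA (eval w)^-1); apply: generated_div => //.
by apply: (@eval_del_coset H) => //; exact: generated_closed.
Qed.

(** Take a shortest word for [h] with letters in [Z]; deletion stays among such words. *)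
Lemma reduced_parabolic_word h : H h ->
  exists w, [/\ eval w = h, all (fun l => `[< Z (x l.1) >]) w &
    forall t, H t -> eval (del t w) = h -> del t w = w].
Proof.
pose P n := `[< exists w, [/\ size w = n, eval w = h &
  all (fun l => `[< Z (x l.1) >]) w] >].
move=> Hh; have exP : exists n, P n.
  have [w wZ wh] := parabolic_word Hh; exists (size w); apply/asboolP.
  by exists w.
case: (ex_minnP exP) => n /asboolP[w [<- wh wZ]] wmin; exists w; split=> // t Ht.
by move=> dwh; apply/del_id/wmin/asboolP; exists (del t w); rewrite all_del.
Qed.

Lemma reduced_conj_generator w v (c := eval w * x v / eval w) :
  (forall t, H t -> del t w = w) -> H c -> c = 1 \/ Z c.
Proof.
move=> wred Hc.
have [p [pc pZ pmin]] := reduced_parabolic_word Hc.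
case: p pc pZ pmin => [|l p] pc; first by rewrite -pc eval_nil; left.
case/andP=> /asboolP Zl pZ pmin; right.
have Hl : H (x l.1) by exact: sub_generated.
have [<- //|/eqP xlc] := x l.1 =P c.
have Hlc : H (x l.1 ^ c) by exact: generated_conj.
(* Both words spell [c d = d x_v], where [d] is the value of [w]. *)
have /(eval_del (x l.1)) : eval ((l :: p) ++ w) = eval (w ++ [:: (v, true)]).
  by rewrite !eval_cat pc eval_cons eval_nil mulg1 mulgVK.
rewrite !del_cat !eval_cat pc !wred // => /(canRL (mulgK _)).
(* The final letter of the right-hand word has reflection [c], so it survives. *)
have /negPf /= -> : x v != x l.1 ^ eval w.
  by apply: contra_neq xlc => E; rewrite /c E conjgE mulVKg mulgK.
(* The deletion keeps the value [c], so by minimality it removes nothing; yet it removes [l]. *)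
rewrite eval_cons eval_nil mulg1 => /(pmin _ Hl)/(congr1 size) /=; rewrite eqxx.
by move=> sz; have := size_del (x l.1 ^ letter l) p; rewrite sz ltnn.
Qed.

End Parabolic.

End WellDefined.

End Deletion.

(** * Transfer to an arbitrary Dyer system *)

Lemma eval_pres_word (G : dyerGraph) (D : groupType)
    (phi : {multiplicative dyer_group G -> D}) w :
  eval (fun v => phi (dyer_gen v)) w = phi (pres_word (@dyer_rel G) w).
Proof.
have phi1 : phi 1 = 1 by apply: (mulgI (phi 1)); rewrite -gmulfM !mulg1.
have phiV a : phi a^-1 = (phi a)^-1.
  by apply/esym/mulg1_eq; rewrite -gmulfM mulgV.
elim: w => [|[v e] w IHw]; first by rewrite eval_nil -phi1.
rewrite eval_cons IHw; have -> : pres_word (@dyer_rel G) ((v, e) :: w)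
    = (pres_word (@dyer_rel G) [:: (v, e)] : dyer_group G) * pres_word (@dyer_rel G) w.
  by rewrite [RHS]pres_mulE.
rewrite gmulfM /letter; congr (_ * _); case: e => //=.
by rewrite -phiV [_^-1]pres_invE.
Qed.

Theorem theoremD (D : groupType) (X : set D) (hX : dyer_system X)
    (g : D) (Y Z : set D) (hY : Y `<=` X) (hZ : Z `<=` X)
    (hYZ : conj_set g (generated Y) `<=` generated Z) :
  exists (h : D) (Y' : set D),
    [/\ generated Z h, Y' `<=` Z &
        conj_set g (generated Y) = conj_set h (generated Y')].
Proof.
have [_ [G [phi [[psi phiK psiK] [_ _ phiX]]]]] := hX.
pose x (v : G) := phi (dyer_gen v).
have evalP w1 w2 : eval x w1 = eval x w2 <-> pres_cong (@dyer_rel G) w1 w2.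
  rewrite !eval_pres_word; split=> [/(can_inj phiK)/pres_wordP//|].
  by move=> /pres_wordP ->.
have eval_surj a : exists w, eval x w = a.
  rewrite -(psiK a); elim/pres_ind: (psi a) => w; exists w.
  exact: eval_pres_word.
have Zx : Z `<=` range x by move=> z /hZ/phiX.
have [w Hgw wred] := reduced_coset_word eval_surj Z g.
(* [Y'] is the part of [d Y d^-1] inside [Z]; with [h = g d^-1] it remains to show that [d D_Y d^-1]
   is generated by [Y']. *)
set d := eval x w in Hgw; pose Y' : set D := [set z | Z z /\ Y (z ^ d)].
exists (g / d), Y'; split=> [//|z []//|].
have Y_sub : generated Y `<=` [set a | generated Y' (a ^ d^-1)].
  apply: generated_sub => [|y Yy /=].
    exact/group_closed_conj/generated_closed.
  have [v _ vy] := phiX _ (hY _ Yy).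
  (* This conjugate is [d y d^-1]. *)
  have : generated Z ((g * y / g) ^ (g / d)).
    apply: generated_conj => //; apply: hYZ.
    by exists y => //; exact: sub_generated.
  rewrite -[_ / g]mulgA -{1}[g]invgK -conjgE -conjgM mulgA mulVg mul1g.
  have -> : y ^ d^-1 = d * x v / d by rewrite conjgE invgK mulgA -vy.
  move=> /(reduced_conj_generator evalP Zx wred)[->|Zc].
    exact: generated1.
  apply: sub_generated; split=> //.
  by rewrite conjgE mulgVK mulKg /x vy.
have Y'_sub : generated Y' `<=` [set a | generated Y (a ^ d)].
  apply: generated_sub => [|z [_ Yzd]].
    exact/group_closed_conj/generated_closed.
  exact: sub_generated.
apply/seteqP; split=> a /conj_setE.
  by move=> /Y_sub /=; rewrite -conjgM => ?; apply/conj_setE.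
by move=> /Y'_sub /=; rewrite -conjgM mulgVK => ?; apply/conj_setE.
Qed.
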